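(* Constructible persistence modules are finitely presentable; that is, for any poset $P$, every constructible $P$-module is finitely presentable.
   Context: Fix a field $k$; a poset $P$ is regarded as a category and a $P$-module (persistence module over $P$) is a functor $M$ from $P$ to finite-dimensional $k$-vector spaces. A co-closure on $P$ is an order-preserving map $c:P\to P$ with $c(p)\le p$ for all $p\in P$ and $c\circ c=c$. A $P$-module $M$ is constructible if there is a co-closure $c:P\to P$ with finite image such that $M\circ c=M$. For $a\in P$ let $a^\uparrow:=\{q\in P:a\le q\}$, and let $k_{a^\uparrow}$ be the $P$-module equal to $k$ on $a^\uparrow$, $0$ elsewhere, with identity maps between points of $a^\uparrow$ and zero maps otherwise. $M$ is finitely presentable if it is isomorphic to the cokernel of a morphism $F_1\to F_0$ with $F_0=\bigoplus_{a\in A}k_{a^\uparrow}$, $F_1=\bigoplus_{b\in B}k_{b^\uparrow}$, where $A,B$ are finite multisets of elements of $P$. *)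

(* Defs.v *)
From HB Require Import structures.
From mathcomp Require Import all_boot all_order all_algebra.
From mathcomp Require Import classical_sets cardinality.

Set Implicit Arguments.
Unset Strict Implicit.
Unset Printing Implicit Defensive.

Import Order.TTheory GRing.Theory.

Local Open Scope ring_scope.
Local Open Scope order_scope.

(* The vector spaces of a module are finite-dimensional because vectType is.  *)
Record pmodule (k : fieldType) (d : Order.disp_t) (P : porderType d) :=
  Pmodule {
    pm_obj :> P -> vectType k;
    pm_map : forall p q : P, p <= q -> 'Hom(pm_obj p, pm_obj q);
    pm_map_id : forall (p : P) (h : p <= p), pm_map h = \1%VF;
    pm_map_comp : forall (p q r : P) (hpq : p <= q) (hqr : q <= r)
      (hpr : p <= r), pm_map hpr = (pm_map hqr \o pm_map hpq)%VF
  }.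

Record pmorphism (k : fieldType) (d : Order.disp_t) (P : porderType d)
    (M N : pmodule k P) :=
  Pmorphism {
    pmor :> forall p : P, 'Hom(M p, N p);
    pmor_natural : forall (p q : P) (h : p <= q),
      (pm_map N h \o pmor p = pmor q \o pm_map M h)%VF
  }.

Definition pm_isomorphic (k : fieldType) (d : Order.disp_t) (P : porderType d)
    (M N : pmodule k P) : Prop :=
  exists (f : pmorphism M N) (g : pmorphism N M),
    forall p : P, (g p \o f p)%VF = \1%VF /\ (f p \o g p)%VF = \1%VF.

(* Cokernels are taken in the category of P-modules: pi : F0 -> C is the      *)
(* universal morphism that vanishes on the image of phi.                      *)
Definition is_cokernel (k : fieldType) (d : Order.disp_t) (P : porderType d)
    (F1 F0 C : pmodule k P) (phi : pmorphism F1 F0) (pi : pmorphism F0 C)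
    : Prop :=
  (forall p : P, (pi p \o phi p)%VF = 0%R) /\
  (forall (N : pmodule k P) (g : pmorphism F0 N),
     (forall p : P, (g p \o phi p)%VF = 0%R) ->
     exists h : pmorphism C N,
       (forall p : P, (h p \o pi p)%VF = g p) /\
       (forall h' : pmorphism C N,
          (forall p : P, (h' p \o pi p)%VF = g p) ->
          forall p : P, h' p = h p)).

Record coclosure (d : Order.disp_t) (P : porderType d) :=
  Coclosure {
    cc_fun :> P -> P;
    cc_homo : {homo cc_fun : p q / p <= q};
    cc_le : forall p : P, cc_fun p <= p;
    cc_idem : forall p : P, cc_fun (cc_fun p) = cc_fun p
  }.

Section Precomposition.
Variables (k : fieldType) (d : Order.disp_t) (P : porderType d).
Variables (M : pmodule k P) (c : P -> P) (c_homo : {homo c : p q / p <= q}).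

Definition pm_precomp : pmodule k P :=
  @Pmodule k d P (fun p => M (c p)) (fun p q h => pm_map M (c_homo h))
    (fun p h => pm_map_id M (c_homo h))
    (fun p q r hpq hqr hpr =>
       pm_map_comp M (c_homo hpq) (c_homo hqr) (c_homo hpr)).

End Precomposition.

(* The equation M o c = M is an equality of functors, not an isomorphism.     *)
Definition constructible (k : fieldType) (d : Order.disp_t) (P : porderType d)
    (M : pmodule k P) : Prop :=
  exists c : coclosure P,
    finite_set (range c) /\ pm_precomp M (@cc_homo d P c) = M.

Section UpSet.
Variables (k : fieldType) (d : Order.disp_t) (P : porderType d) (a : P).

Definition up_space (b : bool) : vectType k :=
  if b then (k^o : vectType k) else ('rV[k]_0 : vectType k).

Definition up_hom (b b' : bool) : 'Hom(up_space b, up_space b') :=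
  match b, b' with
  | true, true => \1%VF
  | _, _ => 0%R
  end.

Lemma up_hom_id (b : bool) : up_hom b b = \1%VF.
Proof.
case: b => //=; apply/lfunP => x; rewrite id_lfunE zero_lfunE.
by rewrite [RHS]thinmx0.
Qed.

Lemma up_hom_comp (b b' b'' : bool) : (b ==> b') -> (b' ==> b'') ->
  up_hom b b'' = (up_hom b' b'' \o up_hom b b')%VF.
Proof.
case: b; case: b'; case: b'' => //= _ _.
- by rewrite comp_lfun1l.
- by rewrite comp_lfun0r.
- by rewrite comp_lfun0r.
- by rewrite comp_lfun0r.
Qed.

Lemma up_implb (p q : P) : p <= q -> (a <= p) ==> (a <= q).
Proof. by move=> h; apply/implyP => /le_trans; apply. Qed.

Definition pm_up : pmodule k P :=
  @Pmodule k d P (fun p => up_space (a <= p))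
    (fun p q _ => up_hom (a <= p) (a <= q))
    (fun p _ => up_hom_id (a <= p))
    (fun p q r hpq hqr _ => up_hom_comp (up_implb hpq) (up_implb hqr)).

End UpSet.

Section DirectSum.
Variables (k : fieldType).

Definition hom_sum_fun (V V' W W' : vectType k) (f : 'Hom(V, W))
    (g : 'Hom(V', W')) (x : V * V') : W * W' := (f x.1, g x.2).

Lemma hom_sum_fun_linear V V' W W' f g : linear (@hom_sum_fun V V' W W' f g).
Proof. by move=> s x y; rewrite /hom_sum_fun /= !linearP. Qed.

HB.instance Definition _ (V V' W W' : vectType k) (f : 'Hom(V, W))
    (g : 'Hom(V', W')) :=
  GRing.isLinear.Build k (V * V')%type (W * W')%type ( *:%R )
    (@hom_sum_fun V V' W W' f g) (@hom_sum_fun_linear V V' W W' f g).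

Definition hom_sum (V V' W W' : vectType k) (f : 'Hom(V, W))
    (g : 'Hom(V', W')) : 'Hom((V * V')%type, (W * W')%type) :=
  linfun (hom_sum_fun f g).

Lemma hom_sum_id (V V' : vectType k) :
  hom_sum (\1%VF : 'End(V)) (\1%VF : 'End(V')) = \1%VF.
Proof.
apply/lfunP => -[x y].
by rewrite lfunE /= /hom_sum_fun /= !id_lfunE.
Qed.

Lemma hom_sum_comp (U U' V V' W W' : vectType k)
    (f : 'Hom(V, W)) (f' : 'Hom(V', W')) (g : 'Hom(U, V)) (g' : 'Hom(U', V')) :
  hom_sum (f \o g)%VF (f' \o g')%VF = (hom_sum f f' \o hom_sum g g')%VF.
Proof.
by apply/lfunP => x; rewrite comp_lfunE !lfunE /= /hom_sum_fun /= !comp_lfunE.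
Qed.

Variables (d : Order.disp_t) (P : porderType d).

Lemma pm_sum_id (M N : pmodule k P) (p : P) (h : p <= p) :
  hom_sum (pm_map M h) (pm_map N h) = \1%VF.
Proof. by rewrite !pm_map_id hom_sum_id. Qed.

Lemma pm_sum_comp (M N : pmodule k P) (p q r : P) (hpq : p <= q) (hqr : q <= r)
    (hpr : p <= r) :
  hom_sum (pm_map M hpr) (pm_map N hpr) =
  (hom_sum (pm_map M hqr) (pm_map N hqr) \o
   hom_sum (pm_map M hpq) (pm_map N hpq))%VF.
Proof.
by rewrite (pm_map_comp M hpq hqr) (pm_map_comp N hpq hqr) hom_sum_comp.
Qed.

Definition pm_sum (M N : pmodule k P) : pmodule k P :=
  @Pmodule k d P (fun p => (M p * N p)%type)
    (fun p q h => hom_sum (pm_map M h) (pm_map N h))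
    (@pm_sum_id M N) (@pm_sum_comp M N).

Definition pm_zero : pmodule k P :=
  @Pmodule k d P (fun _ => 'rV[k]_0) (fun _ _ _ => \1%VF)
    (fun _ _ => erefl) (fun _ _ _ _ _ _ => esym (comp_lfun1l _)).

End DirectSum.

(* A finite multiset of points of P is given by a list; the order of the      *)
(* summands affects the direct sum only up to isomorphism.                    *)
Definition pm_free (k : fieldType) (d : Order.disp_t) (P : porderType d)
    (A : seq P) : pmodule k P :=
  foldr (@pm_sum k d P) (pm_zero k P) [seq pm_up k a | a <- A].

Definition finitely_presentable (k : fieldType) (d : Order.disp_t)
    (P : porderType d) (M : pmodule k P) : Prop :=
  exists (A B : seq P) (phi : pmorphism (pm_free k B) (pm_free k A))
         (C : pmodule k P) (pi : pmorphism (pm_free k A) C),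
    is_cokernel phi pi /\ pm_isomorphic M C.

(* Main.v *)
(** Call [M] local for the co-closure [c] if every [M (c p <= p)] is invertible;
    the equality [M o c = M] forces this, because [M (c (c p) <= c p)] is
    invertible by idempotence.  Bases of the finitely many spaces [M a], with
    [a] in the image of [c], then generate [M], which gives a surjection [pi]
    from a free module [F0] on points fixed by [c].  Such an [F0] is local too
    ([a <= p] iff [a <= c p] when [c a = a]), hence so is the kernel of [pi],
    and the same argument yields a free module [F1] mapping onto this kernel. *)

Require Import Defs.
From HB Require Import structures.
From mathcomp Require Import all_boot all_order all_algebra.
From mathcomp Require Import classical_sets cardinality.

Set Implicit Arguments.
Unset Strict Implicit.
Unset Printing Implicit Defensive.

Import Order.TTheory GRing.Theory.

Local Open Scope ring_scope.
Local Open Scope order_scope.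

Section Modules.
Variables (k : fieldType) (d : Order.disp_t) (P : porderType d).
Implicit Types (M N : pmodule k P) (p q : P).

Lemma pmor_apply M N (f : pmorphism M N) p q (h : p <= q) x :
  pm_map N h (f p x) = f q (pm_map M h x).
Proof. by rewrite -!comp_lfunE pmor_natural. Qed.

Lemma pm_map_comp_apply M p q r (hpq : p <= q) (hqr : q <= r) (hpr : p <= r) x :
  pm_map M hqr (pm_map M hpq x) = pm_map M hpr x.
Proof. by rewrite (pm_map_comp M hpq hqr hpr) comp_lfunE. Qed.

Lemma pm_isomorphic_refl M : pm_isomorphic M M.
Proof.
have id_natural p q (h : p <= q) : (pm_map M h \o \1 = \1 \o pm_map M h)%VF.
  by rewrite comp_lfun1l comp_lfun1r.
by exists (Pmorphism id_natural), (Pmorphism id_natural) => p /=;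
  rewrite comp_lfun1l.
Qed.

Section Copairing.
Variables (M M' N : pmodule k P) (f : pmorphism M N) (g : pmorphism M' N).

Definition copair_fun p (x : M p * M' p) : N p := (f p x.1 + g p x.2)%R.

Lemma copair_fun_linear p : linear (@copair_fun p).
Proof. by move=> s x y; rewrite /copair_fun /= !linearP addrACA scalerDr. Qed.

HB.instance Definition _ p :=
  GRing.isLinear.Build k (M p * M' p)%type (N p) ( *:%R )
    (@copair_fun p) (@copair_fun_linear p).

Lemma copair_natural p q (h : p <= q) :
  (pm_map N h \o (linfun (@copair_fun p) : 'Hom(pm_sum M M' p, N p)) =
   (linfun (@copair_fun q) : 'Hom(pm_sum M M' q, N q)) \o
     pm_map (pm_sum M M') h)%VF.
Proof.
apply/lfunP => x; rewrite !comp_lfunE !lfunE /= /copair_fun /hom_sum_fun /=.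
by rewrite linearD /= !pmor_apply.
Qed.

Definition copair : pmorphism (pm_sum M M') N := Pmorphism copair_natural.

Lemma copairE p (x : M p) (y : M' p) : copair p (x, y) = (f p x + g p y)%R.
Proof. by rewrite lfunE. Qed.

End Copairing.

Definition zero_hom N : pmorphism (pm_zero k P) N.
Proof.
exists (fun p => 0%R : 'Hom(pm_zero k P p, N p)) => p q h.
by rewrite comp_lfun0r comp_lfun0l.
Defined.

Definition scale_vec (V : vectType k) (v : V) (t : k^o) : V := (t : k) *: v.

Lemma scale_vec_linear (V : vectType k) (v : V) : linear (scale_vec v).
Proof. by move=> s t u; rewrite /scale_vec scalerDl scalerA. Qed.

HB.instance Definition _ (V : vectType k) (v : V) :=
  GRing.isLinear.Build k k^o V ( *:%R ) (scale_vec v) (scale_vec_linear v).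

(** Component of a morphism out of [pm_up k a]. Indexing by a boolean lets [a <= p] be treated by
    cases without dependence on the point. *)
Definition scale_lfun (V : vectType k) (v : V) b : 'Hom(up_space k b, V) :=
  match b with true => linfun (scale_vec v) | false => 0%R end.

Lemma comp_scale_lfun (V W : vectType k) (f : 'Hom(V, W)) v w b b' :
    (b ==> b') -> (b -> f v = w) ->
  (f \o scale_lfun v b = scale_lfun w b' \o up_hom k b b')%VF.
Proof.
case: b => [|_ _]; last first.
  by rewrite /= comp_lfun0r; case: b'; rewrite comp_lfun0r.
case: b' => //= _ /(_ isT) fv; apply/lfunP => t.
by rewrite comp_lfun1r comp_lfunE !lfunE /= /scale_vec linearZ /= fv.
Qed.

Lemma limg_scale_lfun (V : vectType k) (v : V) b (W : {vspace V}) :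
  (limg (scale_lfun v b) <= W)%VS <-> (b -> v \in W).
Proof.
case: b => /=; last by rewrite lim0g sub0v.
split=> [/subvP sW _ | /(_ isT) vW].
  apply: sW; apply/memv_imgP; exists (1%R : k^o); first exact: memvf.
  by rewrite lfunE /= /scale_vec scale1r.
apply/subvP => _ /memv_imgP[t _ ->].
by rewrite lfunE /= memvZ.
Qed.

(** Yoneda: the generator [1] at [a] is sent to [x]. Characterizing the image by the subspaces that
    contain it avoids a case split on [a <= q] and passes easily to direct sums. *)
Lemma hom_from_up N (a : P) (x : N a) :
  exists f : pmorphism (pm_up k a) N,
    forall q (W : {vspace N q}),
      (limg (f q) <= W)%VS <-> forall h : a <= q, pm_map N h x \in W.
Proof.
(* [decP] supplies the proof of [a <= q] that [pm_map] needs. The default [0] is harmless, since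
   [scale_lfun] ignores the vector when [a <= q] fails. *)
pose v q : N q := if @decP (a <= q) _ idP is left h then pm_map N h x else 0%R.
have vE q (h : a <= q) : v q = pm_map N h x.
  by rewrite /v; case: decP => // h'; rewrite (bool_irrelevance h' h).
have natural p q (h : p <= q) : (pm_map N h \o scale_lfun (v p) (a <= p) =
    scale_lfun (v q) (a <= q) \o pm_map (pm_up k a) h)%VF.
  apply: comp_scale_lfun (up_implb a h) _ => ap.
  by rewrite !vE ?(le_trans ap h) // => aq; rewrite (pm_map_comp_apply ap h aq).
pose f p : 'Hom(pm_up k a p, N p) := scale_lfun (v p) (a <= p).
exists (@Pmorphism k d P (pm_up k a) N f natural) => q W /=.
rewrite limg_scale_lfun.
by split=> vW h; move: (vW h); rewrite (vE q h).
Qed.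

Lemma limg_copair M M' N (f : pmorphism M N) (g : pmorphism M' N) q
    (W : {vspace N q}) :
  (limg (copair f g q) <= W)%VS <->
  (limg (f q) <= W)%VS /\ (limg (g q) <= W)%VS.
Proof.
split=> [/subvP sW | [/subvP fW /subvP gW]].
  split; apply/subvP => _ /memv_imgP[x _ ->]; apply: sW; apply/memv_imgP.
    by exists (x, 0%R); rewrite ?memvf // copairE linear0 addr0.
  by exists (0%R, x); rewrite ?memvf // copairE linear0 add0r.
apply/subvP => _ /memv_imgP[[x y] _ ->]; rewrite copairE.
by apply: memvD; [apply: fW | apply: gW]; apply: memv_img; apply: memvf.
Qed.

Lemma hom_from_free N (s : seq {a : P & N a}) :
  exists f : pmorphism (pm_free k [seq tag t | t <- s]) N,
    forall q (W : {vspace N q}),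
      (limg (f q) <= W)%VS <->
      forall t, t \in s -> forall h : tag t <= q, pm_map N h (tagged t) \in W.
Proof.
elim: s => [|t s [g gE]].
  by exists (zero_hom N) => q W; rewrite lim0g sub0v.
have [f fE] := hom_from_up (tagged t).
exists (copair f g) => q W; rewrite limg_copair fE gE; split.
  by move=> [tW sW] u; rewrite inE => /predU1P[-> //|/sW].
by move=> sW; split=> [|u us]; apply: sW; rewrite inE ?eqxx // us orbT.
Qed.

Variable c : coclosure P.

(** Here [U] is a submodule of [N] whose value at [p] comes from its value at [c p]. Families of
    subspaces cover both all of [M] and the kernel of [pi], without turning the kernel into a
    module. *)
Lemma free_hom_onto N (U : forall p, {vspace N p}) (C : seq P) :
    (forall p, c p \in C) -> {in C, forall a, c a = a} ->
    (forall p q (h : p <= q), (pm_map N h @: U p <= U q)%VS) ->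
    (forall p, (U p <= pm_map N (cc_le c p) @: U (c p))%VS) ->
  exists (A : seq P) (f : pmorphism (pm_free k A) N),
    {in A, forall a, c a = a} /\ forall p, limg (f p) = U p.
Proof.
move=> cC Cfix U_map U_cc.
pose s : seq {a : P & N a} :=
  [seq Tagged (fun a : P => N a : Type) x
    | a <- C, x <- (vbasis (U a) : seq (N a))].
have [f fE] := hom_from_free s.
exists [seq tag t | t <- s], f; split=> [_ /mapP[t ts ->]|p].
  by have /allpairsPdep[a [x [aC _ ->]]] := ts; apply: Cfix.
apply/eqP; rewrite eqEsubv; apply/andP; split.
  apply/fE => _ /allpairsPdep[a [x [_ xU ->]]] h /=.
  by apply: (subvP (U_map _ _ h)); rewrite memv_img // vbasis_mem.
(* It remains to treat images of vectors of [U (c p)]. Taking the preimage of [limg (f p)] turns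
   this into an inclusion of subspaces, which is checked on the basis of [U (c p)] listed in [s]. *)
apply: subv_trans (U_cc p) _.
apply/subvP => _ /memv_imgP[x xU ->]; rewrite memv_preim.
move: x xU; apply/subvP.
rewrite -(span_basis (vbasisP (U (c p)))); apply/span_subvP => x xU.
rewrite -memv_preim.
have xs : Tagged (fun a : P => N a : Type) x \in s.
  by apply/allpairsPdep; exists (c p), x; split.
by have /fE/(_ _ xs (cc_le c p)) := subvv (limg (f p)).
Qed.

Lemma pm_free_map_onto (A : seq P) p : {in A, forall a, c a = a} ->
  (fullv <= limg (pm_map (pm_free k A) (cc_le c p)))%VS.
Proof.
elim: A => [|a A IH] Afix.
  by rewrite /= lim1g.
have /IH/subvP Aonto: {in A, forall b, c b = b}.
  by move=> b bA; apply: Afix; rewrite inE bA orbT.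
have ac : (a <= c p) = (a <= p).
  apply/idP/idP => [h|/(cc_homo c)]; first exact: le_trans h (cc_le c p).
  by rewrite Afix ?mem_head.
apply/subvP => -[x y] _.
have /memv_imgP[y' _ yE] := Aonto y (memvf y).
(* Rewriting with [ac] while [x] is generalized makes the two spaces of this summand the same type,
   with the identity between them. *)
have [x' xE] : exists x', x = pm_map (pm_up k a) (cc_le c p) x'.
  move: x => /=; rewrite ac => x.
  by exists x; rewrite up_hom_id id_lfunE.
apply/memv_imgP; exists (x', y'); first exact: memvf.
by rewrite /= lfunE /= /hom_sum_fun /= -/(pm_free k A) -yE xE.
Qed.

Definition local M := forall p, exists g : 'Hom(M p, M (c p)),
  (g \o pm_map M (cc_le c p) = \1)%VF /\ (pm_map M (cc_le c p) \o g = \1)%VF.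

Lemma local_precomp M : local (pm_precomp M (@cc_homo d P c)).
Proof.
move=> p /=.
(* The inverse is the map of this reverse inequality, so nothing is transported along
   [c (c p) = c p]. *)
have h : c p <= c (c p) by rewrite cc_idem.
by exists (pm_map M h); rewrite -!pm_map_comp // !pm_map_id.
Qed.

(** The factorization of [g] is [g p] after a linear section of [pi p]. The sections need not be
    natural, but two preimages of a vector differ by an element of the image of [phi], which [g]
    kills; so the composite is natural. *)
Lemma cokernel_of_exact (F1 F0 M : pmodule k P) (phi : pmorphism F1 F0)
    (pi : pmorphism F0 M) :
    (forall p, limg (phi p) = lker (pi p)) -> (forall p, limg (pi p) = fullv) ->
  is_cokernel phi pi.
Proof.
move=> exact_pi pi_onto; split=> [p|N g g_phi].
  apply/lfunP => x; rewrite comp_lfunE zero_lfunE; apply/eqP.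
  by rewrite -memv_ker -exact_pi memv_img ?memvf.
have piK p y : pi p ((pi p)^-1%VF y) = y.
  by rewrite limg_lfunVK // pi_onto memvf.
have g_fact p x : g p ((pi p)^-1%VF (pi p x)) = g p x.
  apply/eqP; rewrite -subr_eq0 -linearB /=.
  have: (pi p)^-1%VF (pi p x) - x \in lker (pi p).
    by rewrite memv_ker linearB /= piK subrr.
  rewrite -exact_pi => /memv_imgP[z _ ->].
  by rewrite -comp_lfunE g_phi zero_lfunE.
have natural p q (h : p <= q) : (pm_map N h \o (g p \o (pi p)^-1) =
    (g q \o (pi q)^-1) \o pm_map M h)%VF.
  apply/lfunP => y; rewrite !comp_lfunE -{2}(piK p y).
  by rewrite (pmor_apply pi) g_fact pmor_apply.
exists (Pmorphism natural); split=> [p|h' h'pi p]; apply/lfunP => x /=.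
  by rewrite !comp_lfunE g_fact.
by rewrite comp_lfunE -h'pi comp_lfunE piK.
Qed.

Lemma local_finitely_presentable M (C : seq P) :
    (forall p, c p \in C) -> {in C, forall a, c a = a} -> local M ->
  finitely_presentable M.
Proof.
move=> cC Cfix M_local.
have [|p|A [pi [Afix pi_onto]]] :=
  @free_hom_onto M (fun p => fullv) C cC Cfix.
- by move=> p q h; rewrite subvf.
- have [g [_ gK]] := M_local p; apply/subvP => x _.
  by apply/memv_imgP; exists (g x); rewrite ?memvf // -comp_lfunE gK id_lfunE.
have [|p|B [phi [_ phi_ker]]] :=
  @free_hom_onto (pm_free k A) (fun p => lker (pi p)) C cC Cfix.
- move=> p q h; apply/subvP => _ /memv_imgP[x /[!memv_ker]/eqP x0 ->].
  by rewrite -pmor_apply x0 linear0.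
- apply/subvP => x; rewrite memv_ker => /eqP x0.
  (* Lift [x] to some [y] at [c p]. By naturality the structure map of [M] sends [pi (c p) y] to
     [pi p x = 0], and its left inverse [g] shows that [y] is in the kernel. *)
  have /memv_imgP[y _ xE] := subvP (pm_free_map_onto p Afix) x (memvf x).
  have [g [gK _]] := M_local p.
  apply/memv_imgP; exists y => //; rewrite memv_ker.
  by rewrite -[pi _ y]id_lfunE -gK comp_lfunE pmor_apply -xE x0 linear0.
exists A, B, phi, M, pi; split; last exact: pm_isomorphic_refl.
exact: cokernel_of_exact.
Qed.

End Modules.

Theorem proposition3p5 (k : fieldType) (d : Order.disp_t) (P : porderType d)
    (M : pmodule k P) (hM : constructible M) : finitely_presentable M.
Proof.
have [c [/finite_seqP[C rangeE] McE]] := hM.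
have CE p : p \in C <-> exists q, c q = p.
  have <- : range c p <-> exists q, c q = p.
    by split=> [[q _ <-]|[q <-]]; exists q.
  by rewrite rangeE.
apply: (@local_finitely_presentable _ _ _ c M C).
- by move=> p; apply/CE; exists p.
- by move=> a /CE[q <-]; rewrite cc_idem.
by rewrite -McE; apply: local_precomp.
Qed.
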